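(* Let $\Pi_1=\Pi_2=\Pi_3=\Pi_{\rm st}(2)$. The image of the map $m=(m_{i,j,k}):(\mathbb T^{\Pi_{\rm st}(2)})^3\to\mathbb T^{\Delta^3(2)}$ coincides with the cone defined by the rhombus inequalities and the tetrahedron equality. That is, a vector $x\in\mathbb R^{\Delta^3(2)}$ with $x_{0,0,0}=0$ is of the form $m(w_1,w_2,w_3)$ for some weightings $w_1,w_2,w_3\in\mathbb T^{\Pi_{\rm st}(2)}$ if and only if (1) for each small rhombus in $\Delta^3(2)$, the sum of the values of $x$ on the short diagonal is at least the sum of the values on the long diagonal, and (2) the maximum $$\max\{x_{0,0,1}+x_{1,1,0},\ x_{0,1,0}+x_{1,0,1},\ x_{1,0,0}+x_{0,1,1}\}$$ is attained by at least two of the three expressions.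
   Context: **Planar networks.** $\mathbb T=\mathbb R\cup\{-\infty\}$. The standard network $\Pi_{\rm st}(2)$ has two horizontal lines 1 (bottom) and 2 (top), line $l$ joining source $l$ (left) to sink $l$ (right), and one slanted edge going, left to right, from an interior vertex of line 2 down to an interior vertex of line 1. All edges are oriented left to right; so there are five edges (two on each line and the slanted one). A weighting is a map from edges to $\mathbb T$. The concatenation $\Pi_1\circ\Pi_2\circ\Pi_3$ glues the $i$-th sink of each network to the $i$-th source of the next. An $a$-multipath is a collection of $a$ pairwise vertex-disjoint oriented paths from sources to sinks. For $\underline\alpha=(\alpha_1,\alpha_2,\alpha_3)$, an $\underline\alpha$-multipath in $\Pi_1\circ\Pi_2\circ\Pi_3$ is a triple $(p_1,p_2,p_3)$ of pairwise vertex-disjoint multipaths, $p_i$ being an $\alpha_i$-multipath in $\Pi_1\circ\dots\circ\Pi_i$ (from sources of $\Pi_1$ to sinks of $\Pi_i$). Its weight is the sum of the weights of all its edges. **The map $m$.** $\Delta^3(2)=\{(i,j,k)\in\mathbb Z_{\ge0}^3:i+j+k\le2\}$; $m_{i,j,k}(w_1,w_2,w_3)$ is the maximal weight of an $(i,j,k)$-multipath ($-\infty$ if none), $m_{0,0,0}=0$. **Small rhombi.** Identify $\Delta^3(2)$ with $\{x\in\mathbb Z_{\ge0}^4:x_0+x_1+x_2+x_3=2\}$ via $x_0=2-x_1-x_2-x_3$. For pairwise distinct $a,b,c\in\{0,1,2,3\}$ there is a small rhombus with short diagonal $\{e_a+e_b,e_a+e_c\}$ and long diagonal $\{2e_a,e_b+e_c\}$;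 these are all the small rhombi. *)

(* Defs.v *)
From HB Require Import structures.
From mathcomp Require Import all_boot all_order all_algebra.
From mathcomp Require Import boolp classical_sets reals ereal.

Set Implicit Arguments.
Unset Strict Implicit.
Unset Printing Implicit Defensive.

Import Order.TTheory GRing.Theory Num.Theory.

Record network (n : nat) := Network {
  vertex : finType;
  edge : finType;
  tail : edge -> vertex;
  head : edge -> vertex;
  source : 'I_n -> vertex;
  sink : 'I_n -> vertex }.

Section Concatenation.
Variables (n : nat) (N1 N2 : network n).

(* The sources of [N2] are removed; [glue] sends the [i]-th of them to the
   [i]-th sink of [N1] (the sources of a network are meant to be distinct). *)
Definition cat_vertex : finType :=
  (vertex N1 + {v : vertex N2 | v \notin codom (@source n N2)})%type.

Definition glue (v : vertex N2) : cat_vertex :=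
  match boolP (v \in codom (@source n N2)) with
  | AltTrue h => inl (@sink n N1 (iinv h))
  | AltFalse h => inr (exist _ v h)
  end.

Definition concat : network n := {|
  vertex := cat_vertex;
  edge := (edge N1 + edge N2)%type;
  tail := fun e => match e with
                   | inl e1 => inl (tail e1)
                   | inr e2 => glue (tail e2)
                   end;
  head := fun e => match e with
                   | inl e1 => inl (head e1)
                   | inr e2 => glue (head e2)
                   end;
  source := fun i => inl (@source n N1 i);
  sink := fun i => glue (@sink n N2 i) |}.

End Concatenation.

(* Lines 1 (bottom) and 2 (top) are [ord0] and [ord_max] in ['I_2].  The
   vertices of line [l] are [(l, 0)], [(l, 1)], [(l, 2)], from left to right;
   [Some (l, k)] is the edge from [(l, k)] to [(l, k + 1)], and [None] is the
   slanted edge. *)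
Definition Pi_st2 : network 2 := {|
  vertex := ('I_2 * 'I_3)%type;
  edge := option ('I_2 * 'I_2);
  tail := fun e => match e with
                   | Some (l, k) => (l, widen_ord (leqnSn 2) k)
                   | None => (ord_max, Ordinal (isT : 1 < 3))
                   end;
  head := fun e => match e with
                   | Some (l, k) => (l, lift ord0 k)
                   | None => (ord0, Ordinal (isT : 1 < 3))
                   end;
  source := fun l => (l, ord0);
  sink := fun l => (l, ord_max) |}.

Section Paths.
Variables (n : nat) (N : network n).

Fixpoint walk (v : vertex N) (s : seq (edge N)) (v' : vertex N) : bool :=
  if s is e :: s' then (tail e == v) && walk (head e) s' v' else v == v'.

(* The index of the source from which the path starts, and its edges; a source
   index of [N1] is also one of [concat N1 N2]. *)
Definition npath : Type := ('I_n * seq (edge N))%type.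

Definition is_npath (p : npath) : bool :=
  [exists j : 'I_n, walk (source N p.1) p.2 (sink N j)].

Definition npath_vertices (p : npath) : seq (vertex N) :=
  source N p.1 :: map (@head n N) p.2.

Definition vertex_disjoint (p q : npath) : bool :=
  ~~ has (mem (npath_vertices q)) (npath_vertices p).

(* The collection is listed in some order; since a path has a vertex, disjoint
   paths are distinct. *)
Definition multipath (a : nat) (ps : seq npath) : bool :=
  [&& size ps == a, all is_npath ps & pairwise vertex_disjoint ps].

End Paths.

Definition npath_inl (n : nat) (N1 N2 : network n) (p : npath N1) :
    npath (concat N1 N2) :=
  (p.1, map inl p.2).

(* The tropical numbers, i.e., the reals together with -oo. *)
Definition trop (R : realType) : Type := {x : \bar R | x != +oo%E}.

Definition weighting (R : realType) (n : nat) (N : network n) : Type :=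
  edge N -> trop R.

Section MaxWeight.
Variables (R : realType) (n : nat) (N1 N2 N3 : network n).

Definition concat3 : network n := concat (concat N1 N2) N3.

Definition multipath_triple : Type :=
  (seq (npath N1) * seq (npath (concat N1 N2)) * seq (npath concat3))%type.

Definition triple_paths (t : multipath_triple) : seq (npath concat3) :=
  let: (p1, p2, p3) := t in
  map (fun p => npath_inl N3 (npath_inl N2 p)) p1
    ++ map (fun p => npath_inl N3 p) p2 ++ p3.

Definition multipath3 (a : nat * nat * nat) (t : multipath_triple) : bool :=
  let: (a1, a2, a3) := a in
  let: (p1, p2, p3) := t in
  [&& multipath a1 p1, multipath a2 p2, multipath a3 p3
    & pairwise (@vertex_disjoint _ _) (triple_paths t)].

Variables (w1 : weighting R N1) (w2 : weighting R N2) (w3 : weighting R N3).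

Definition weight3 (e : edge concat3) : \bar R :=
  match e with
  | inl (inl e1) => val (w1 e1)
  | inl (inr e2) => val (w2 e2)
  | inr e3 => val (w3 e3)
  end.

Definition triple_weight (t : multipath_triple) : \bar R :=
  (\sum_(p <- triple_paths t) \sum_(e <- p.2) weight3 e)%E.

(* In a finite acyclic network there are only finitely many multipaths, so
   the supremum is a maximum; it is -oo when there is no multipath. *)
Definition max_weight (a : nat * nat * nat) : \bar R :=
  ereal_sup [set triple_weight t | t in [set t | multipath3 a t]]%classic.

End MaxWeight.

Definition Delta32 : Type :=
  {a : nat * nat * nat | a.1.1 + a.1.2 + a.2 <= 2}.

Definition pt (i j k : nat) (h : i + j + k <= 2) : Delta32 :=
  exist _ (i, j, k) h.

(* The point [e_a + e_b], of which the coordinates 1, 2, 3 are kept. *)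
Lemma bary_subproof (a b : 'I_4) :
  ((a == 1 :> nat) + (b == 1 :> nat)) + ((a == 2 :> nat) + (b == 2 :> nat))
    + ((a == 3 :> nat) + (b == 3 :> nat)) <= 2.
Proof. by case: a b => [[|[|[|[|a]]]] ?] [[|[|[|[|b]]]] ?]. Qed.

Definition bary (a b : 'I_4) : Delta32 := pt (bary_subproof a b).

Local Open Scope ring_scope.

Definition rhombus_inequalities (R : realType) (x : Delta32 -> R) : Prop :=
  forall a b c : 'I_4, uniq [:: a; b; c] ->
    x (bary a a) + x (bary b c) <= x (bary a b) + x (bary a c).

Definition max_attained_twice (R : realType) (u v t : R) : bool :=
  (2 <= count_mem (Num.max u (Num.max v t)) [:: u; v; t])%N.

Definition tetrahedron_equality (R : realType) (x : Delta32 -> R) : Prop :=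
  max_attained_twice (x (@pt 0 0 1 isT) + x (@pt 1 1 0 isT))
                     (x (@pt 0 1 0 isT) + x (@pt 1 0 1 isT))
                     (x (@pt 1 0 0 isT) + x (@pt 0 1 1 isT)).

(* Main.v *)
(** A path through the first [k] blocks is determined by the lines on which it
    crosses the block boundaries, a nonincreasing word; two paths are disjoint
    iff they are on opposite lines at every common boundary.  Hence every
    coordinate of [m] is an explicit tropical polynomial in the weights [ti],
    [bi], [si] of the top, bottom and slanted paths through the blocks.  For
    real values of [m] the [ti] and [bi] are finite, and an infinite [si] can be
    replaced by a very negative real number, so the theorem becomes a statement
    about maxima of real linear forms.  There the conditions follow by comparing
    monomials, and conversely a preimage is written down in each of the three
    cases of the tetrahedron equality. *)

Require Import Defs.
From mathcomp Require Import all_boot all_order all_algebra.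
From mathcomp Require Import reals ereal.
From mathcomp Require Import classical_sets lra zify.

Set Implicit Arguments.
Unset Strict Implicit.
Unset Printing Implicit Defensive.

(* [Defs.head], the head of an edge, must shadow [seq.head]. *)
Import Defs.
Import Order.TTheory GRing.Theory Num.Theory.

(** * Walks in a concatenation *)

Section ConcatWalks.
Variables (n : nat) (N1 N2 : network n).
Hypothesis source_inj : injective (@source n N2).
Hypothesis headP : forall e : edge N2, head e \notin codom (@source n N2).

Lemma glue_source i : glue N1 (source N2 i) = inl (sink N1 i).
Proof.
(* The third occurrence is the index of [alt_spec]; generalising it alone keeps the case split well
   typed. *)
rewrite /glue; move: (boolP _); move: {3}(_ \in _).
move=> _ [h|/negP []]; last exact: codom_f.
by congr (inl (sink _ _)); apply: source_inj; exact: f_iinv.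
Qed.

Lemma glueN v (h : v \notin codom (@source n N2)) :
  glue N1 v = inr (exist _ v h).
Proof.
rewrite /glue; move: (boolP _); move: {3}(_ \in _).
move=> _ [h'|h']; first by have := h; rewrite h'.
by congr (inr (exist _ _ _)); exact: bool_irrelevance.
Qed.

Lemma glue_inlP v u : glue N1 v = inl u ->
  exists2 i, v = source N2 i & u = sink N1 i.
Proof.
have [/codomP[i ->]|h] := boolP (v \in codom (@source n N2)).
  by rewrite glue_source => -[<-]; exists i.
by rewrite glueN.
Qed.

Lemma glue_eqN u v : u \notin codom (@source n N2) ->
  (glue N1 v == glue N1 u) = (v == u).
Proof.
move=> hu; apply/eqP/eqP => [|-> //]; rewrite (glueN hu).
have [/codomP[i ->]|h] := boolP (v \in codom (@source n N2)).
  by rewrite glue_source.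
by rewrite glueN => -[].
Qed.

Lemma walk_cat (N : network n) (u v w : vertex N) s t :
  walk u s v -> walk v t w -> walk u (s ++ t) w.
Proof. by elim: s u => [|e s IH] u /= => [/eqP -> //|/andP[-> /IH h] /h]. Qed.

Lemma walk_inl (u v : vertex N1) s :
  walk u s v -> walk (N := concat N1 N2) (inl u) (map inl s) (inl v).
Proof.
by elim: s u => [|e s IH] u /= => [/eqP -> //|/andP[/eqP -> /IH ->]];
  rewrite eqxx.
Qed.

Lemma walk_glue (u v : vertex N2) s :
  walk u s v -> walk (N := concat N1 N2) (glue N1 u) (map inr s) (glue N1 v).
Proof.
by elim: s u => [|e s IH] u /= => [/eqP -> //|/andP[/eqP -> /IH ->]];
  rewrite eqxx.
Qed.

(** By [headP], a walk that has left the sources of [N2] never meets them again, so it cannot return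
    to [N1]. *)
Lemma walk_glueN (u v : vertex N2) s : u \notin codom (@source n N2) ->
  walk (N := concat N1 N2) (glue N1 u) s (glue N1 v) ->
  exists2 t, s = map inr t & walk u t v.
Proof.
elim: s u => [|[e|e] s IH] u hu /=.
- by rewrite eq_sym glue_eqN // => /eqP ->; exists [::] => /=.
- by rewrite (glueN hu).
- rewrite glue_eqN // => /andP[/eqP te /IH[//|t -> ht]].
  by exists (e :: t); rewrite //= te eqxx.
Qed.

(** The word is cut before its first edge of [N2], whose tail must be a source glued to a sink of
    [N1]; without such an edge, the target itself is such a source. *)
Lemma walk_concatP (v : vertex N1) s j :
  walk (N := concat N1 N2) (inl v) s (sink (concat N1 N2) j) <->
  exists s1 i s2, [/\ s = map inl s1 ++ map inr s2,
    walk v s1 (sink N1 i) & walk (source N2 i) s2 (sink N2 j)].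
Proof.
split; last first.
  move=> [s1 [i [s2 [-> h1 h2]]]]; apply: walk_cat (walk_inl h1) _.
  by rewrite -glue_source; exact: walk_glue.
elim: s v => [|[e|e] s IH] v /=.
- rewrite eq_sym => /eqP/glue_inlP[i hj ->].
  by exists [::], i, [::]; rewrite /= hj !eqxx.
- move=> /andP[/eqP[te] /IH[s1 [i [s2 [-> h1 h2]]]]].
  by exists (e :: s1), i, s2; rewrite /= te eqxx.
- move=> /andP[/eqP/glue_inlP[i te ->]].
  move=> /(walk_glueN (headP e))[t -> ht].
  by exists [::], i, (e :: t); rewrite /= te !eqxx.
Qed.

End ConcatWalks.

Section Inl.
Variables (n : nat) (N1 N2 : network n).

Lemma npath_vertices_inl (p : npath N1) :
  npath_vertices (npath_inl N2 p) = map inl (npath_vertices p).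
Proof. by rewrite /npath_vertices /= -!map_comp. Qed.

Lemma vertex_disjoint_inl (p q : npath N1) :
  vertex_disjoint (npath_inl N2 p) (npath_inl N2 q) = vertex_disjoint p q.
Proof.
rewrite /vertex_disjoint !npath_vertices_inl has_map; congr (~~ _).
by apply: eq_has => v; apply: mem_map; exact: inl_inj.
Qed.

End Inl.

(** * Paths through the three blocks *)

Definition line (b : bool) : 'I_2 := if b then ord_max else ord0.

Lemma lineP l : exists b, l = line b.
Proof.
by case: l => [[|[|//]] ?]; [exists false|exists true]; apply: val_inj.
Qed.

(** Meaningful for [c <= b] only: the value at [false], [true] is not a walk. *)
Definition seg (b c : bool) : seq (edge Pi_st2) :=
  if b == c then [:: Some (line b, ord0); Some (line b, ord_max)]
  else [:: Some (line b, ord0); None; Some (line c, ord_max)].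

Lemma source_st2_inj : injective (source Pi_st2).
Proof. by move=> i j [->]. Qed.

Lemma head_st2N (e : edge Pi_st2) : head e \notin codom (source Pi_st2).
Proof. by apply/negP => /codomP[i]; case: e => [[l k]|] []. Qed.

(** Here [line c] serves as the position of the edge along its line, both indices being in
    ['I_2]. *)
Lemma edge_st2P (e : edge Pi_st2) :
  e = None \/ exists b c, e = Some (line b, line c).
Proof.
case: e => [[l k]|]; last by left.
by right; have [b ->] := lineP l; have [c ->] := lineP k; exists b, c.
Qed.

Lemma walk_st2P b c s :
  walk (source Pi_st2 (line b)) s (sink Pi_st2 (line c)) <->
  c <= b /\ s = seg b c.
Proof.
split; last by move=> [+ ->]; case: b; case: c.
case: b; case: c;
  (* No walk across a block has more than three edges, so four splittings exhaust the word. *)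
  do 4 (case: s => [|e s]; first [by []
    | have [->|[[] [[] ->]]] := edge_st2P e; clear e => //=]); by split.
Qed.

Local Notation Pi12 := (concat Pi_st2 Pi_st2).
Local Notation Pi123 := (concat3 Pi_st2 Pi_st2 Pi_st2).

Definition path1 b0 b1 : npath Pi_st2 := (line b0, seg b0 b1).
Definition path2 b0 b1 b2 : npath Pi12 :=
  (line b0, map inl (seg b0 b1) ++ map inr (seg b1 b2)).
Definition path3 b0 b1 b2 b3 : npath Pi123 :=
  (line b0,
   map inl (map inl (seg b0 b1) ++ map inr (seg b1 b2)) ++ map inr (seg b2 b3)).

(** Peels off the last block; used once for two blocks and twice for three. *)
Lemma walk_st2_cat (N : network 2) (v : vertex N) s b :
  walk (N := concat N Pi_st2) (inl v) s (sink (concat N Pi_st2) (line b)) <->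
  exists s1 (c : bool), [/\ s = map inl s1 ++ map inr (seg c b), b <= c &
    walk v s1 (sink N (line c))].
Proof.
rewrite walk_concatP; [|exact: source_st2_inj|exact: head_st2N].
split=> [[s1 [i [s2 [-> + +]]]]|[s1 [c [-> bc h1]]]].
  by have [c ->] := lineP i; move=> h1 /walk_st2P[bc ->]; exists s1, c.
by exists s1, (line c), (seg c b); split=> //; apply/walk_st2P.
Qed.

Lemma is_npath1P (p : npath Pi_st2) :
  is_npath p <-> exists b0 b1 : bool, b1 <= b0 /\ p = path1 b0 b1.
Proof.
case: p => l s; have [b0 ->] := lineP l; split.
  move=> /existsP[j]; have [b1 ->] := lineP j.
  by move=> /= /walk_st2P[h ->]; exists b0, b1.
move=> [c0 [c1 [h [-> ->]]]]; apply/existsP; exists (line c1).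
exact/walk_st2P.
Qed.

Lemma is_npath2P (p : npath Pi12) :
  is_npath p <-> exists b0 b1 b2 : bool,
    [/\ b1 <= b0, b2 <= b1 & p = path2 b0 b1 b2].
Proof.
case: p => l s; have [b0 ->] := lineP l; split.
  move=> /existsP[j]; have [b2 ->] := lineP j.
  move=> /= /walk_st2_cat[s1 [b1 [-> h2 /walk_st2P[h1 ->]]]].
  by exists b0, b1, b2.
move=> [c0 [c1 [c2 [h1 h2 [-> ->]]]]]; apply/existsP; exists (line c2).
by apply/walk_st2_cat; exists (seg c0 c1), c1; split=> //; exact/walk_st2P.
Qed.

Lemma is_npath3P (p : npath Pi123) :
  is_npath p <-> exists b0 b1 b2 b3 : bool,
    [/\ b1 <= b0, b2 <= b1, b3 <= b2 & p = path3 b0 b1 b2 b3].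
Proof.
case: p => l s; have [b0 ->] := lineP l; split.
  move=> /existsP[j]; have [b3 ->] := lineP j.
  move=> /= /walk_st2_cat[_ [b2 [-> h3 /walk_st2_cat[s1 [b1 [-> h2]]]]]].
  by move=> /= /walk_st2P[h1 ->]; exists b0, b1, b2, b3.
move=> [c0 [c1 [c2 [c3 [h1 h2 h3 [-> ->]]]]]]; apply/existsP; exists (line c3).
apply/walk_st2_cat; eexists; exists c2; split=> //.
by apply/walk_st2_cat; exists (seg c0 c1), c1; split=> //; exact/walk_st2P.
Qed.

(* A path is encoded by the lines on which it crosses the boundaries of the
   blocks; [true] is the top line. *)
Definition codes1 : seq (seq bool) :=
  [:: [:: true; true]; [:: true; false]; [:: false; false]].
Definition codes2 : seq (seq bool) :=
  [:: [:: true; true; true]; [:: true; true; false]; [:: true; false; false];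
      [:: false; false; false]].
Definition codes3 : seq (seq bool) :=
  [:: [:: true; true; true; true]; [:: true; true; true; false];
      [:: true; true; false; false]; [:: true; false; false; false];
      [:: false; false; false; false]].

(** The length of a code tells how many blocks are crossed, so one list can mix codes from all three
    multipaths. Other lengths give a dummy path. *)
Definition code_path (c : seq bool) : npath Pi123 :=
  match c with
  | [:: b0; b1] => npath_inl Pi_st2 (npath_inl Pi_st2 (path1 b0 b1))
  | [:: b0; b1; b2] => npath_inl Pi_st2 (path2 b0 b1 b2)
  | [:: b0; b1; b2; b3] => path3 b0 b1 b2 b3
  | _ => (ord0, [::])
  end.

Lemma codes1P (p : npath Pi_st2) : is_npath p ->
  exists2 c, c \in codes1 &
    npath_inl Pi_st2 (npath_inl Pi_st2 p) = code_path c.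
Proof.
move=> /is_npath1P[b0 [b1 [h ->]]]; exists [:: b0; b1] => //.
by case: b0 b1 h => [] [].
Qed.

Lemma codes2P (p : npath Pi12) : is_npath p ->
  exists2 c, c \in codes2 & npath_inl Pi_st2 p = code_path c.
Proof.
move=> /is_npath2P[b0 [b1 [b2 [h1 h2 ->]]]]; exists [:: b0; b1; b2] => //.
by case: b0 b1 b2 h1 h2 => [] [] [].
Qed.

Lemma codes3P (p : npath Pi123) : is_npath p ->
  exists2 c, c \in codes3 & p = code_path c.
Proof.
move=> /is_npath3P[b0 [b1 [b2 [b3 [h1 h2 h3 ->]]]]].
exists [:: b0; b1; b2; b3] => //.
by case: b0 b1 b2 b3 h1 h2 h3 => [] [] [] [].
Qed.

Lemma code_path1 c : c \in codes1 -> exists2 p : npath Pi_st2, is_npath p &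
  npath_inl Pi_st2 (npath_inl Pi_st2 p) = code_path c.
Proof.
rewrite !inE => /or3P[] /eqP -> /=; eexists; try reflexivity;
by apply/is_npath1P; do 2 eexists; split; last reflexivity.
Qed.

Lemma code_path2 c : c \in codes2 -> exists2 p : npath Pi12, is_npath p &
  npath_inl Pi_st2 p = code_path c.
Proof.
rewrite !inE => /or4P[] /eqP -> /=; eexists; try reflexivity;
by apply/is_npath2P; do 3 eexists; split; last reflexivity.
Qed.

Lemma code_path3 c : c \in codes3 -> is_npath (code_path c).
Proof.
rewrite !inE => /or4P[|||/orP[]] /eqP -> /=;
by apply/is_npath3P; do 4 eexists; split; last reflexivity.
Qed.

(* The coordinates of the vertices in the planar drawing of the network; they
   make vertex-disjointness of coded paths computable. *)
Definition position (v : vertex Pi123) : nat * nat :=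
  match v with
  | inl (inl u) => (u.1 : nat, u.2 : nat)
  | inl (inr u) => ((sval u).1 : nat, (sval u).2 + 2)
  | inr u => ((sval u).1 : nat, (sval u).2 + 4)
  end.

Definition head_position (e : edge Pi123) : nat * nat :=
  match e with
  | inl (inl e) => ((head e).1 : nat, (head e).2 : nat)
  | inl (inr e) => ((head e).1 : nat, (head e).2 + 2)
  | inr e => ((head e).1 : nat, (head e).2 + 4)
  end.

Lemma position_head e : position (head e) = head_position e.
Proof. by case: e => [[]|] e //=; rewrite (glueN _ (head_st2N e)). Qed.

Lemma position_inj : injective position.
Proof.
(* Vertices kept from blocks 2 and 3 are not sources, so their shifted columns are 3, 4 and 5, 6:
   the column determines the block. *)
have col (l : 'I_2) (k : 'I_3) :
    ((l, k) : vertex Pi_st2) \notin codom (source Pi_st2) -> 0 < k.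
  move=> h; rewrite lt0n; move: h; apply: contra => /eqP k0.
  by apply/codomP; exists l; congr pair; exact: val_inj.
have eqv (l l' : 'I_2) (k k' : 'I_3) (i : nat) :
    l = l' :> nat -> k + i = k' + i -> (l, k) = (l', k').
  by move=> el ek; congr pair; apply: val_inj; rewrite //= (addIn ek).
move=> [[[l k]|[[l k] h]]|[[l k] h]] [[[l' k']|[[l' k'] h']]|[[l' k'] h']] [];
  try (have := col _ _ h); try (have := col _ _ h');
  move: (ltn_ord k) (ltn_ord k') => /=; try lia; move=> _ _.
- by move=> el ek; rewrite (eqv l l' k k' 0) ?ek.
- by move=> _ _ el ek; congr (inl (inr _)); apply: val_inj; exact: eqv el ek.
- by move=> _ _ el ek; congr inr; apply: val_inj; exact: eqv el ek.
Qed.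

Definition positions (p : npath Pi123) : seq (nat * nat) :=
  (p.1 : nat, 0) :: map head_position p.2.

Lemma vertex_disjoint_positions (p q : npath Pi123) :
  vertex_disjoint p q = ~~ has (mem (positions q)) (positions p).
Proof.
have positionsE r : positions r = map position (npath_vertices r).
  rewrite /positions /npath_vertices /= -map_comp; congr cons.
  by apply: eq_map => e; rewrite /= position_head.
rewrite /vertex_disjoint !positionsE has_map; congr (~~ _).
by apply: eq_has => v; apply/esym/mem_map; exact: position_inj.
Qed.

(* Two disjoint paths stay on opposite lines: this rules out slanted edges. *)
Definition code_disjoint (c d : seq bool) : bool :=
  all (fun bb => bb.1 != bb.2) (zip c d).

(** With vertices replaced by positions, this is a finite check on pairs of codes. [zip] truncates
    to the shorter code, as two paths can only meet in the blocks that both cross. *)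
Lemma vertex_disjoint_codes c d :
    c \in codes1 ++ codes2 ++ codes3 -> d \in codes1 ++ codes2 ++ codes3 ->
  vertex_disjoint (code_path c) (code_path d) = code_disjoint c d.
Proof.
move=> hc hd; rewrite vertex_disjoint_positions.
set C := codes1 ++ _ in hc hd.
suff /allrelP/(_ c d hc hd)/eqP : allrel (fun c d =>
    ~~ has (mem (positions (code_path d))) (positions (code_path c)) ==
    code_disjoint c d) C C by [].
by vm_compute.
Qed.

(** * Enumeration of the disjoint families of coded paths *)

Fixpoint words (T : Type) (s : seq T) (k : nat) : seq (seq T) :=
  if k is k'.+1 then [seq x :: u | x <- s, u <- words s k'] else [:: [::]].

Lemma mem_words (T : eqType) (s : seq T) k u :
  (u \in words s k) = (size u == k) && all (mem s) u.
Proof.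
elim: k u => [|k IH] [|x u] //=.
  by apply/negbTE/allpairsP => -[[y v] []].
rewrite eqSS andbCA -IH; apply/allpairsP/andP => /=.
  by case=> [[y v]] [/= hy hv [-> ->]].
by move=> [hx hu]; exists (x, u).
Qed.

(** Families are ordered lists, in the order of [triple_paths]; a multipath recurs once per
    ordering, which does not affect the maximum. *)
Definition code_families (a : nat * nat * nat) : seq (seq (seq bool)) :=
  [seq cs <- [seq u ++ vw | u <- words codes1 a.1.1,
                vw <- [seq v ++ w | v <- words codes2 a.1.2,
                                    w <- words codes3 a.2]]
   | pairwise code_disjoint cs].

(** Disjointness inside each multipath follows from that of the whole triple, since [npath_inl]
    preserves and reflects it. *)
Lemma multipath3E a (p1 : seq (npath Pi_st2)) (p2 : seq (npath Pi12)) p3 :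
  multipath3 a (p1, p2, p3) <->
  [/\ size p1 = a.1.1 /\ all (@is_npath 2 Pi_st2) p1,
      size p2 = a.1.2 /\ all (@is_npath 2 Pi12) p2,
      size p3 = a.2 /\ all (@is_npath 2 Pi123) p3
    & pairwise (@vertex_disjoint 2 Pi123) (triple_paths (p1, p2, p3))].
Proof.
case: a => [[a1 a2] a3]; rewrite /= /multipath; split.
  by case/and4P => /and3P[/eqP s1 h1 _] /and3P[/eqP s2 h2 _]
    /and3P[/eqP s3 h3 _] h.
move=> [[-> ->] [-> ->] [-> ->] h]; rewrite !eqxx h !andbT /=.
move: h; rewrite !pairwise_cat !pairwise_map => /and3P[_ h1 /and3P[_ h2 ->]].
apply/and3P; split=> //.
  by apply: sub_pairwise h1 => p q /=; rewrite !vertex_disjoint_inl.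
by apply: sub_pairwise h2 => p q /=; rewrite vertex_disjoint_inl.
Qed.

Lemma map_code_path (T : Type) (P : pred T) (f : T -> npath Pi123) C ps :
    (forall p, P p -> exists2 c, c \in C & f p = code_path c) ->
  all P ps -> exists2 cs, cs \in words C (size ps) & map f ps = map code_path cs.
Proof.
move=> hf; elim: ps => [|p ps IH] /=; first by exists [::].
move=> /andP[/hf[c hc ->] /IH[cs hcs ->]]; exists (c :: cs) => //.
by apply/allpairsP; exists (c, cs).
Qed.

Lemma code_path_map (T : Type) (P : pred T) (f : T -> npath Pi123) C cs k :
    (forall c, c \in C -> exists2 p, P p & f p = code_path c) ->
    cs \in words C k ->
  exists ps, [/\ size ps = k, all P ps & map f ps = map code_path cs].
Proof.
move=> hf; elim: k cs => [|k IH] cs.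
  by rewrite inE => /eqP ->; exists [::].
case/allpairsP => -[c u] [/= /hf[p hp fp] /IH[ps [sz hps fps]] ->].
by exists (p :: ps); rewrite /= hp sz hps fp fps.
Qed.

Lemma pairwise_codes cs : all (mem (codes1 ++ codes2 ++ codes3)) cs ->
  pairwise (@vertex_disjoint 2 Pi123) (map code_path cs) =
  pairwise code_disjoint cs.
Proof.
by move=> h; rewrite pairwise_map; apply: eq_in_pairwise h => c d hc hd;
  exact: vertex_disjoint_codes.
Qed.

(** Stated through the common list of paths [ps], which is all that the weight depends on. *)
Lemma code_familiesP a ps :
  (exists2 t, multipath3 a t & triple_paths t = ps) <->
  (exists2 cs, cs \in code_families a & map code_path cs = ps).
Proof.
have all_codes u v w : u \in words codes1 a.1.1 -> v \in words codes2 a.1.2 ->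
    w \in words codes3 a.2 ->
    all (mem (codes1 ++ codes2 ++ codes3)) (u ++ v ++ w).
  rewrite !mem_words => /andP[_ hu] /andP[_ hv] /andP[_ hw].
  rewrite !all_cat; apply/and3P; split; [move: hu|move: hv|move: hw];
    apply: sub_all => c; rewrite -![mem _ _]/(_ \in _) !mem_cat => ->;
    by rewrite ?orbT.
split=> [[[[p1 p2] p3]]|[cs]].
  move=> /multipath3E[[s1 h1] [s2 h2] [s3 h3]] /= + <-.
  have [u hu eu] := map_code_path codes1P h1.
  have [v hv ev] := map_code_path codes2P h2.
  have [w hw ew] := map_code_path (f := id) codes3P h3.
  rewrite s1 in hu; rewrite s2 in hv; rewrite s3 in hw; rewrite map_id in ew.
  rewrite eu ev ew -!map_cat => h; exists (u ++ v ++ w) => //.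
  rewrite mem_filter -pairwise_codes ?h ?all_codes //=.
  by apply: allpairs_f => //; apply: allpairs_f.
rewrite mem_filter => /andP[hp /allpairsP[[u vw] [/= hu /allpairsP]]].
move=> [[v w] [/= hv hw ->]] ecs <-; subst cs.
have [p1 [s1 h1 e1]] := code_path_map code_path1 hu.
have [p2 [s2 h2 e2]] := code_path_map code_path2 hv.
have [|p3 [s3 h3]] := code_path_map (P := @is_npath 2 Pi123) (f := id) _ hw.
  by move=> c /code_path3; exists (code_path c).
rewrite map_id => e3; exists (p1, p2, p3); last by rewrite /= e1 e2 e3 !map_cat.
apply/multipath3E; split=> //; move: hp.
by rewrite -pairwise_codes ?all_codes //= e1 e2 e3 !map_cat.
Qed.

(** * Weights *)

Section Weights.
Local Open Scope ereal_scope.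
Variable R : realType.

Definition block_weight (w : weighting R Pi_st2) (b c : bool) : \bar R :=
  \sum_(e <- seg b c) val (w e).

Variables w1 w2 w3 : weighting R Pi_st2.

Definition code_weight (c : seq bool) : \bar R :=
  match c with
  | [:: b0; b1] => block_weight w1 b0 b1
  | [:: b0; b1; b2] => block_weight w1 b0 b1 + block_weight w2 b1 b2
  | [:: b0; b1; b2; b3] =>
      block_weight w1 b0 b1 + block_weight w2 b1 b2 + block_weight w3 b2 b3
  | _ => 0
  end.

Lemma sum_code_path c :
  \sum_(e <- (code_path c).2) weight3 w1 w2 w3 e = code_weight c.
Proof.
case: c => [|b0 [|b1 [|b2 [|b3 [|b4 c]]]]]; rewrite ?big_nil //=.
- by rewrite !big_map.
- by rewrite map_cat !big_cat /= !big_map.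
- by rewrite !map_cat !big_cat /= !big_map.
Qed.

Definition family_weight (cs : seq (seq bool)) : \bar R :=
  \sum_(c <- cs) code_weight c.

Lemma multipath_weights a :
  ([set triple_weight w1 w2 w3 t | t in [set t | multipath3 a t]] =
   [set x | x \in map family_weight (code_families a)])%classic.
Proof.
apply/seteqP; split=> [_ [t ht <-]|x /= /mapP[cs hcs ->]].
  have [|cs hcs ecs] := (code_familiesP a (triple_paths t)).1; first by exists t.
  apply/mapP; exists cs => //; rewrite /triple_weight -ecs big_map.
  by apply: eq_bigr => c _; exact: sum_code_path.
have [|t ht et] := (code_familiesP a (map code_path cs)).2; first by exists cs.
exists t => //; rewrite /triple_weight et big_map.
by apply: eq_bigr => c _; exact: sum_code_path.
Qed.
End Weights.

(** A relation rather than a function: it needs no default value, serves both [R] and [\bar R], and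
    unfolds to the disjunctions and inequalities that [lra] accepts. *)
Definition is_max d (T : porderType d) (v : T) (s : seq T) : Prop :=
  v \in s /\ all (fun y => y <= v)%O s.

Lemma ereal_sup_seq (R : realType) (v : \bar R) (s : seq (\bar R)) :
  s != [::] -> (ereal_sup [set x | x \in s]%classic = v <-> is_max v s).
Proof.
move=> s0.
have sup_max u : is_max u s -> ereal_sup [set x | x \in s]%classic = u.
  move=> [us /allP hu]; apply/eqP; rewrite eq_le; apply/andP; split.
    by apply: ub_ereal_sup => y; exact: hu.
  exact: ereal_sup_ubound.
split=> [<-|]; last exact: sup_max.
(* By [sup_max] any maximum equals the supremum, so its existence suffices. *)
suff [u hu] : exists u, is_max u s by rewrite (sup_max u hu).
elim: s s0 {sup_max} => // y [|z s] IH _.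
  by exists y; rewrite /is_max inE /= lexx eqxx.
have [//|u [us hu]] := IH.
have [yu|/ltW uy] := leP y u; [exists u|exists y]; split.
- by rewrite inE us orbT.
- by rewrite [all _ _]/= yu.
- by rewrite inE eqxx.
- rewrite [all _ _]/= lexx /=; apply: sub_all hu => t tu; exact: le_trans uy.
Qed.

Lemma max_weightP (R : realType) (w1 w2 w3 : weighting R Pi_st2)
    (a : Delta32) v :
  v = max_weight w1 w2 w3 (val a) <->
  is_max v (map (family_weight w1 w2 w3) (code_families (val a))).
Proof.
rewrite /max_weight multipath_weights.
have h : map (family_weight w1 w2 w3) (code_families (val a)) != [::].
  rewrite -size_eq0 size_map.
  by case: a => [[[[|[|[|i]]] [|[|[|j]]]] [|[|[|k]]]] h] //; vm_compute.
by split=> [/esym /(ereal_sup_seq _ h)|/(ereal_sup_seq _ h) ->].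
Qed.

(** * The system over the reals *)

Local Open Scope ring_scope.

(* [ti], [bi] and [si] are the weights of the top, bottom and slanted paths
   through the i-th block; [add] is the addition of [R] or of [\bar R]. *)
Definition block_system d (T : porderType d) (add : T -> T -> T)
    (x100 x010 x001 x200 x020 x002 x110 x101 x011 : T)
    (t1 b1 s1 t2 b2 s2 t3 b3 s3 : T) : Prop :=
  let: ttt := add (add t1 t2) t3 in let: tts := add (add t1 t2) s3 in
  let: tsb := add (add t1 s2) b3 in let: sbb := add (add s1 b2) b3 in
  let: bbb := add (add b1 b2) b3 in
  [/\ [/\ x200 = add t1 b1, x020 = add (add t1 t2) (add b1 b2)
        & x002 = add ttt bbb],
      [/\ is_max x100 [:: t1; s1; b1],
        is_max x010 [:: add t1 t2; add t1 s2; add s1 b2; add b1 b2]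
        & is_max x001 [:: ttt; tts; tsb; sbb; bbb]]
    & [/\ is_max x110 [:: add t1 (add b1 b2); add b1 (add t1 t2);
                          add b1 (add t1 s2)],
        is_max x101 [:: add t1 bbb; add b1 ttt; add b1 tts; add b1 tsb]
        & is_max x011 [:: add (add t1 t2) bbb; add (add b1 b2) ttt;
                          add (add b1 b2) tts]]].

Section RealSystem.
Variable R : realFieldType.
Variables x100 x010 x001 x200 x020 x002 x110 x101 x011 : R.

Local Notation real_system :=
  (block_system +%R x100 x010 x001 x200 x020 x002 x110 x101 x011).

(** The rhombi are grouped by the vertex [2 e_a] of the long diagonal, [a = 0, 1, 2, 3], with
    [x000 = 0]. The last group says that no term of the tetrahedron maximum strictly exceeds both
    others. *)
Definition block_conditions : Prop :=
  [/\ [/\ [/\ x110 <= x100 + x010, x101 <= x100 + x001 & x011 <= x010 + x001],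
      [/\ x200 + x010 <= x100 + x110, x200 + x001 <= x100 + x101
        & x200 + x011 <= x110 + x101],
      [/\ x020 + x100 <= x010 + x110, x020 + x001 <= x010 + x011
        & x020 + x101 <= x110 + x011]
    & [/\ x002 + x100 <= x001 + x101, x002 + x010 <= x001 + x011
        & x002 + x110 <= x101 + x011]]
    & [/\ x001 + x110 <= x010 + x101 \/ x001 + x110 <= x100 + x011,
          x010 + x101 <= x001 + x110 \/ x010 + x101 <= x100 + x011
        & x100 + x011 <= x001 + x110 \/ x100 + x011 <= x010 + x101]].

(** Monomials attaining the left side (hypotheses [o]) are regrouped into monomials bounded by the
    right side (hypotheses [u]); each [clear] keeps just these, which limits the case splits of
    [lra]. *)
Lemma block_system_conditions t1 b1 s1 t2 b2 s2 t3 b3 s3 :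
  real_system t1 b1 s1 t2 b2 s2 t3 b3 s3 -> block_conditions.
Proof.
rewrite /block_system /is_max !inE /= !andbT.
move=> [[e200 e020 e002] [[o100 u100] [o010 u010] [o001 u001]]
        [[o110 u110] [o101 u101] [o011 u011]]].
split; do !split.
- clear -o110 u100 u010; lra.
- clear -o101 u100 u001; lra.
- clear -o011 u010 u001; lra.
- clear -e200 o010 u100 u110; lra.
- clear -e200 o001 u100 u101; lra.
- clear -e200 o011 u110 u101; lra.
- clear -e020 o100 u010 u110; lra.
- clear -e020 o001 u010 u011; lra.
- clear -e020 o101 u110 u011; lra.
- clear -e002 o100 u001 u101; lra.
- clear -e002 o010 u001 u011; lra.
- clear -e002 o110 u101 u011; lra.
- clear -o001 o110 u010 u101 u100 u011; lra.
- clear -o010 o101 u001 u110 u100 u011; lra.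
- clear -o100 o011 u001 u110 u010 u101; lra.
Qed.

Lemma block_conditions_system : block_conditions ->
  exists t1 b1 s1 t2 b2 s2 t3 b3 s3 : R,
    real_system t1 b1 s1 t2 b2 s2 t3 b3 s3.
Proof.
(* [di = ti + bi], [Mi] is the maximum of the i-th block ([M1 = x100]) and
   [N23] that of the blocks 2 and 3.  Choosing [si = Mi] makes the second term of
   the tetrahedron equality the maximum of the two others; this covers the first
   two cases.  In the third case [t2] attains [M2] and [s2 = b2]. *)
pose d1 := x200; pose d2 := x020 - x200; pose d3 := x002 - x020.
pose M2 := x110 - d1; pose M3 := x011 - d1 - d2; pose N23 := x101 - d1.
move=> [[[r1 r2 r3] [r4 r5 r6] [r7 r8 r9] [r10 r11 r12]] [hp hq hu]].
(* The letters [p], [q], [u] stand for [x001 + x110], [x010 + x101], [x100 + x011]. *)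
have [[pq uq]|[[pq qu]|[pu qu]]] :
    (x001 + x110 = x010 + x101 /\ x100 + x011 <= x010 + x101) \/
    (x001 + x110 <= x010 + x101 /\ x010 + x101 = x100 + x011) \/
    (x001 + x110 = x100 + x011 /\ x010 + x101 <= x100 + x011).
- clear -hp hq hu; lra.
(* Here [t1 + s2 = x010] and [t2 + s3 = s2 + b3 = N23]; the equality of the case makes [tsb] attain
   [x001]. *)
- exists (x010 - M2), (d1 - (x010 - M2)), x100, (N23 - M3), (d2 - (N23 - M3)),
    M2, (d3 - (N23 - M2)), (N23 - M2), M3.
  rewrite /block_system /is_max !inE /= /M2 /M3 /N23 /d1 /d2 /d3.
  do !split; lra.
(* Here [t2 + s3 = N23] and [t1 + N23 = x001], so [tts] attains [x001]; the equality of the case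
   gives [s1 + b2 = x010]. *)
- exists (x001 - N23), (d1 - (x001 - N23)), x100, (N23 - M3), (d2 - (N23 - M3)),
    M2, (d3 - (x001 - x010)), (x001 - x010), M3.
  rewrite /block_system /is_max !inE /= /M2 /M3 /N23 /d1 /d2 /d3.
  do !split; lra.
(* Here [t1 + t2 = x010] and [t2 + s3 = N23]; the equality of the case makes [sbb] attain [x001]. *)
- exists (x010 - M2), (d1 - (x010 - M2)), x100, M2, (d2 - M2), (d2 - M2),
    (d3 - M3), M3, (N23 - M2).
  rewrite /block_system /is_max !inE /= /M2 /M3 /N23 /d1 /d2 /d3.
  do !split; lra.
Qed.
End RealSystem.

(** * The conditions of the theorem as explicit inequalities *)

Section RhombusInequalities.
Variables (R : realType) (x : Delta32 -> R).
Hypothesis x000 : x (@pt 0 0 0 isT) = 0.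
Local Notation x100 := (x (@pt 1 0 0 isT)).
Local Notation x010 := (x (@pt 0 1 0 isT)).
Local Notation x001 := (x (@pt 0 0 1 isT)).
Local Notation x200 := (x (@pt 2 0 0 isT)).
Local Notation x020 := (x (@pt 0 2 0 isT)).
Local Notation x002 := (x (@pt 0 0 2 isT)).
Local Notation x110 := (x (@pt 1 1 0 isT)).
Local Notation x101 := (x (@pt 1 0 1 isT)).
Local Notation x011 := (x (@pt 0 1 1 isT)).

Lemma baryE (a b : 'I_4) : x (bary a b) =
  match val a, val b with
  | 0, 0 => 0%R
  | 0, 1 | 1, 0 => x100
  | 0, 2 | 2, 0 => x010
  | 0, 3 | 3, 0 => x001
  | 1, 1 => x200
  | 2, 2 => x020
  | 3, 3 => x002
  | 1, 2 | 2, 1 => x110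
  | 1, 3 | 3, 1 => x101
  | 2, 3 | 3, 2 => x011
  | _, _ => 0%R
  end%N.
Proof.
case: a b => [[|[|[|[|//]]]] ha] [[|[|[|[|//]]]] hb] /=; rewrite -?x000;
  by congr x; apply: val_inj; vm_compute.
Qed.

Lemma rhombus_inequalitiesE : rhombus_inequalities x <->
  [/\ [/\ x110 <= x100 + x010, x101 <= x100 + x001 & x011 <= x010 + x001],
      [/\ x200 + x010 <= x100 + x110, x200 + x001 <= x100 + x101
        & x200 + x011 <= x110 + x101],
      [/\ x020 + x100 <= x010 + x110, x020 + x001 <= x010 + x011
        & x020 + x101 <= x110 + x011]
    & [/\ x002 + x100 <= x001 + x101, x002 + x010 <= x001 + x011
        & x002 + x110 <= x101 + x011]].
Proof.
split=> [h|[[? ? ?] [? ? ?] [? ? ?] [? ? ?]] a b c].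
  pose o i (hi : (i < 4)%N) := Ordinal hi.
  have h' i j k (hi : (i < 4)%N) hj hk := h (@o i hi) (@o j hj) (@o k hk).
  (* A rhombus depends on [a] and the unordered pair [b], [c]: twelve instances. *)
  have := h' 0%N 1%N 2%N isT isT isT isT; have := h' 0%N 1%N 3%N isT isT isT isT.
  have := h' 0%N 2%N 3%N isT isT isT isT; have := h' 1%N 0%N 2%N isT isT isT isT.
  have := h' 1%N 0%N 3%N isT isT isT isT; have := h' 1%N 2%N 3%N isT isT isT isT.
  have := h' 2%N 0%N 1%N isT isT isT isT; have := h' 2%N 0%N 3%N isT isT isT isT.
  have := h' 2%N 1%N 3%N isT isT isT isT; have := h' 3%N 0%N 1%N isT isT isT isT.
  have := h' 3%N 0%N 2%N isT isT isT isT; have := h' 3%N 1%N 2%N isT isT isT isT.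
  by rewrite !baryE /= => *; do !split; lra.
rewrite !baryE; case: a b c => [[|[|[|[|//]]]] ?] [[|[|[|[|//]]]] ?];
  by move=> [[|[|[|[|//]]]] ?] //= _; rewrite ?add0r // [leRHS]addrC.
Qed.

End RhombusInequalities.

Lemma max_attained_twiceE (R : realType) (u v t : R) :
  max_attained_twice u v t <->
  [/\ u <= v \/ u <= t, v <= u \/ v <= t & t <= u \/ t <= v].
Proof.
rewrite /max_attained_twice /=.
have ltE (a b : R) : a < b -> ((a == b) = false) * ((b == a) = false).
  by move=> ab; rewrite lt_eqF // gt_eqF.
case: (ltgtP v t) => [vt|tv|->];
  [case: (ltgtP u t) => [ut|tu|->]|case: (ltgtP u v) => [uv|vu|->]
  |case: (ltgtP u t) => [ut|tu|->]]; rewrite ?eqxx.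
- by rewrite (ltE _ _ ut) (ltE _ _ vt); split=> // -[_ _ []].
- have vu := lt_trans vt tu; rewrite (ltE _ _ tu) (ltE _ _ vu) /= leNgt vu.
  by split=> // -[[]].
- by rewrite (ltE _ _ vt); split=> // _; split; auto.
- by rewrite (ltE _ _ uv) (ltE _ _ tv); split=> // -[_ []].
- have tu := lt_trans tv vu; rewrite (ltE _ _ vu) (ltE _ _ tu) /= (leNgt u) tu.
  by split=> // -[[]].
- by rewrite (ltE _ _ tv); split=> // _; split; auto.
- by rewrite (ltE _ _ ut); split=> // _; split; auto.
- by rewrite (ltE _ _ tu); split=> // -[[]].
- by split=> // _; split; auto.
Qed.

(** * Reduction to the reals *)

Lemma Delta32_forall (P : Delta32 -> Prop) : (forall a, P a) <->
  [/\ P (@pt 0 0 0 isT),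
      [/\ P (@pt 2 0 0 isT), P (@pt 0 2 0 isT) & P (@pt 0 0 2 isT)],
      [/\ P (@pt 1 0 0 isT), P (@pt 0 1 0 isT) & P (@pt 0 0 1 isT)]
    & [/\ P (@pt 1 1 0 isT), P (@pt 1 0 1 isT) & P (@pt 0 1 1 isT)]].
Proof.
split=> // -[? [? ? ?] [? ? ?] [? ? ?]].
by move=> [[[[|[|[|i]]] [|[|[|j]]]] [|[|[|k]]]] h] //;
  rewrite (bool_irrelevance h isT).
Qed.

Section Blocks.
Local Open Scope ereal_scope.
Variables (R : realType) (x : Delta32 -> R).
Hypothesis x000 : x (@pt 0 0 0 isT) = 0%R.

(** For [x200], [x020], [x002] the only disjoint pair is the top and the bottom path, listed in both
    orders. *)
Lemma is_max_addC (v a b : \bar R) : is_max v [:: a + b; b + a] <-> v = a + b.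
Proof.
rewrite (addeC b) /is_max !inE orbb /= andbT andbb.
by split=> [[/eqP]|->]; rewrite ?eqxx ?lexx.
Qed.

Definition is_max_weight (w1 w2 w3 : weighting R Pi_st2) (a : Delta32) :=
  is_max (x a)%:E (map (family_weight w1 w2 w3) (code_families (val a))).

Lemma max_weights_system (w1 w2 w3 : weighting R Pi_st2) :
  (forall a : Delta32, (x a)%:E = max_weight w1 w2 w3 (val a)) <->
  block_system +%E
    (x (@pt 1 0 0 isT))%:E (x (@pt 0 1 0 isT))%:E (x (@pt 0 0 1 isT))%:E
    (x (@pt 2 0 0 isT))%:E (x (@pt 0 2 0 isT))%:E (x (@pt 0 0 2 isT))%:E
    (x (@pt 1 1 0 isT))%:E (x (@pt 1 0 1 isT))%:E (x (@pt 0 1 1 isT))%:E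
    (block_weight w1 true true) (block_weight w1 false false)
    (block_weight w1 true false)
    (block_weight w2 true true) (block_weight w2 false false)
    (block_weight w2 true false)
    (block_weight w3 true true) (block_weight w3 false false)
    (block_weight w3 true false).
Proof.
have -> : (forall a : Delta32, (x a)%:E = max_weight w1 w2 w3 (val a)) <->
    (forall a, is_max_weight w1 w2 w3 a).
  by split=> h a; apply/max_weightP/h.
rewrite Delta32_forall /is_max_weight.
(* [block_system] lists and brackets its monomials as this evaluation produces them, so both sides
   then agree syntactically, up to [is_max_addC]. *)
repeat match goal with |- context [code_families ?a] =>
  let l := eval vm_compute in (code_families a) in
  have -> : code_families a = l by vm_compute
end.
rewrite /family_weight /= !big_cons !big_nil /= !adde0.
rewrite x000; split=> [[_ [h1 h2 h3] [h4 h5 h6] [h7 h8 h9]]|].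
  by split; split=> //; apply/is_max_addC.
move=> [[h1 h2 h3] [h4 h5 h6] [h7 h8 h9]]; split=> //; split=> //;
  try exact/is_max_addC.
- by rewrite inE.
- by rewrite /= lexx.
Qed.

Lemma block_system_EFin (y100 y010 y001 y200 y020 y002 y110 y101 y011 : R)
    (t1 b1 s1 t2 b2 s2 t3 b3 s3 : R) :
  block_system +%R y100 y010 y001 y200 y020 y002 y110 y101 y011
    t1 b1 s1 t2 b2 s2 t3 b3 s3 ->
  block_system +%E y100%:E y010%:E y001%:E y200%:E y020%:E y002%:E
    y110%:E y101%:E y011%:E
    t1%:E b1%:E s1%:E t2%:E b2%:E s2%:E t3%:E b3%:E s3%:E.
Proof.
have EFin_max v s : is_max v s -> is_max v%:E (map EFin s).
  move=> [vs h]; split; first exact: map_f.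
  by rewrite all_map; apply: sub_all h => r /=; rewrite lee_fin.
move=> [[-> -> ->]].
by move=> [/EFin_max h1 /EFin_max h2 /EFin_max h3]
  [/EFin_max h4 /EFin_max h5 /EFin_max h6].
Qed.

(* Where the weight [e] is infinite, the bound [v] makes [r] harmless in a
   maximum equal to [v]. *)
Definition approximates (v : R) (e : \bar R) (r : R) : bool :=
  (e == r%:E) || (e == -oo) && (r <= v)%R.

Lemma approximatesDl v e r c : approximates (v - c)%R e r ->
  approximates v (c%:E + e) (c + r)%R.
Proof.
case/orP => [/eqP ->|/andP[/eqP -> h]]; first by rewrite /approximates eqxx.
by apply/orP; right; rewrite addeNy eqxx /=; lra.
Qed.

Lemma approximatesDr v e r c : approximates (v - c)%R e r ->
  approximates v (e + c%:E) (r + c)%R.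
Proof. by rewrite addeC (addrC r); exact: approximatesDl. Qed.

Lemma approximates_fin v r : approximates v r%:E r.
Proof. by rewrite /approximates eqxx. Qed.

Lemma is_max_approximates v s t :
  is_max v%:E s -> all2 (approximates v) s t -> is_max v t.
Proof.
move=> [vs us] st; split.
  elim: s t vs us st => [|e s IH] [|r t] //.
  rewrite !inE /= => /orP[/eqP ev|vs] /andP[ue us] /andP[er st].
    by move: er; rewrite /approximates -ev /= orbF eqe => ->.
  by rewrite IH ?orbT.
elim: s t us st {vs} => [|e s IH] [|r t] //= /andP[ue us] /andP[er st].
rewrite IH // andbT; move: er ue.
by case/orP => [/eqP ->|/andP[_ ->]] //; rewrite lee_fin.
Qed.

(** A slanted weight occurs in several maxima, so one real number must meet all bounds at once; for
    [-oo] their minimum does. *)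
Lemma exists_approximates (e : \bar R) (vs : seq R) : e != +oo ->
  exists r, all (fun v => approximates v e r) vs.
Proof.
case: e => [r| |] // _.
  by exists r; apply/allP => v _; exact: approximates_fin.
exists (foldr Num.min 0%R vs); rewrite /approximates /=.
elim: vs => //= v vs IH; rewrite ge_min lexx /=.
by apply: sub_all IH => u; rewrite ge_min => ->; rewrite orbT.
Qed.

Ltac approximate :=
  repeat first [done | assumption | apply/andP; split | exact: approximates_fin
    | apply: approximatesDl | apply: approximatesDr].

Lemma block_system_real (y100 y010 y001 y200 y020 y002 y110 y101 y011 : R)
    (T1 B1 S1 T2 B2 S2 T3 B3 S3 : \bar R) :
  S1 != +oo -> S2 != +oo -> S3 != +oo ->
  block_system +%E y100%:E y010%:E y001%:E y200%:E y020%:E y002%:E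
    y110%:E y101%:E y011%:E T1 B1 S1 T2 B2 S2 T3 B3 S3 ->
  exists t1 b1 s1 t2 b2 s2 t3 b3 s3 : R,
    block_system +%R y100 y010 y001 y200 y020 y002 y110 y101 y011
      t1 b1 s1 t2 b2 s2 t3 b3 s3.
Proof.
move=> S1oo S2oo S3oo [[e200 e020 e002]].
(* A finite sum has finite terms, so the equation for [y002] alone makes every [ti] and [bi]
   finite. *)
have add_fin (v : R) a b : v%:E = a + b ->
    (exists r, a = r%:E) /\ (exists r, b = r%:E).
  by case: a b => [r| |] [s| |] //= _; split; [exists r|exists s].
have [[ttt ettt] [bbb ebbb]] := add_fin _ _ _ e002.
have [[tt ett] [t3 et3]] := add_fin _ _ _ (esym ettt).
have [[bb ebb] [b3 eb3]] := add_fin _ _ _ (esym ebbb).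
have [[t1 et1] [t2 et2]] := add_fin _ _ _ (esym ett).
have [[b1 eb1] [b2 eb2]] := add_fin _ _ _ (esym ebb).
subst T1 T2 T3 B1 B2 B3; clear ttt ettt bbb ebbb tt ett bb ebb add_fin.
(* Each bound is the value of a maximum minus the other summands of its monomial in the slanted
   weight, subtracted in the order in which [approximate] peels them off. *)
have [s1 /and4P[? ? ? _]] :=
  exists_approximates [:: y100; y010 - b2; y001 - b3 - b2]%R S1oo.
have [s2 /and5P[? ? ? ? _]] := exists_approximates
  [:: y010 - t1; y001 - b3 - t1; y110 - b1 - t1; y101 - b1 - b3 - t1]%R S2oo.
have [s3 /and4P[? ? ? _]] := exists_approximates
  [:: y001 - (t1 + t2); y101 - b1 - (t1 + t2);
      y011 - (b1 + b2) - (t1 + t2)]%R S3oo.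
move=> [h1 h2 h3] [h4 h5 h6].
exists t1, b1, s1, t2, b2, s2, t3, b3, s3; split.
- by move: e200 e020 e002; rewrite -!EFinD => -[->] [->] [->].
- by split; [apply: is_max_approximates h1 _|apply: is_max_approximates h2 _
    |apply: is_max_approximates h3 _]; rewrite -?EFinD /=; approximate.
- by split; [apply: is_max_approximates h4 _|apply: is_max_approximates h5 _
    |apply: is_max_approximates h6 _]; rewrite -?EFinD /=; approximate.
Qed.

Definition trop_fin (r : R) : trop R := exist _ r%:E isT.

(** [t] sits on the last top edge and [b] on the first bottom edge, which the slanted path avoids;
    so the three path weights are independent. *)
Definition block_weighting (t b s : R) : weighting R Pi_st2 := fun e =>
  match e with
  | None => trop_fin s
  | Some (l, k) =>
      trop_fin (if l == k then (if l == ord0 then b else t) else 0%R)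
  end.

Lemma block_weightingE t b s :
  [/\ block_weight (block_weighting t b s) true true = t%:E,
      block_weight (block_weighting t b s) false false = b%:E
    & block_weight (block_weighting t b s) true false = s%:E].
Proof.
by split; rewrite /block_weight /seg /= !big_cons big_nil /= ?add0e !adde0.
Qed.

Lemma block_weight_noo (w : weighting R Pi_st2) b c : block_weight w b c != +oo.
Proof.
rewrite /block_weight; elim/big_ind: _ => // [e f|e _]; 
  last exact: (valP (w e)).
by case: e f => [e| |] [f| |].
Qed.
End Blocks.

Theorem propositionA4 (R : realType) (x : Delta32 -> R)
    (hx0 : x (@pt 0 0 0 isT) = 0%R) :
  (exists w1 w2 w3 : weighting R Pi_st2,
     forall a : Delta32, (x a)%:E%E = max_weight w1 w2 w3 (val a))
  <-> rhombus_inequalities x /\ tetrahedron_equality x.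
Proof.
rewrite rhombus_inequalitiesE // /tetrahedron_equality max_attained_twiceE.
split=> [[w1 [w2 [w3 /(max_weights_system hx0)]]]|].
  case/block_system_real; do ?exact: block_weight_noo.
  move=> t1 [b1 [s1 [t2 [b2 [s2 [t3 [b3 [s3 h]]]]]]]].
  by have [] := block_system_conditions h.
case=> rh te; have [] := block_conditions_system (conj rh te).
move=> t1 [b1 [s1 [t2 [b2 [s2 [t3 [b3 [s3 h]]]]]]]].
exists (block_weighting t1 b1 s1), (block_weighting t2 b2 s2),
  (block_weighting t3 b3 s3); apply/(max_weights_system hx0).
have [-> -> ->] := block_weightingE t1 b1 s1.
have [-> -> ->] := block_weightingE t2 b2 s2.
have [-> -> ->] := block_weightingE t3 b3 s3.
exact: block_system_EFin.
Qed.
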